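(* Let $\Bbbk$ be a commutative ring with unit $1\neq 0$ and without zero divisors. Let $p(x)=x^n+c_1x^{n-1}+\dots+c_n\in\Bbbk[x]$ be a monic polynomial which has all roots in $\Bbbk$, i.e. $p(x)=(x-\alpha_1)^{\mu_1}\cdots(x-\alpha_k)^{\mu_k}$ with pairwise distinct $\alpha_1,\dots,\alpha_k\in\Bbbk$ and integers $\mu_u\ge 1$. Let $S\subset \operatorname{Ker}p(L)$ be the $\Bbbk$-submodule generated by the sequences $s(\alpha_u,a)$, $1\le u\le k$, $0\le a\le\mu_u-1$. Then the quotient $\Bbbk$-module $\operatorname{Ker}p(L)/S$ is a torsion module, i.e. for every element $m$ of it there is a nonzero $c\in\Bbbk$ with $cm=0$.
   Context: $\mathfrak{S}_\Bbbk$ denotes the $\Bbbk$-module of all sequences $s=(s_0,s_1,\dots)$ of elements of $\Bbbk$ with termwise operations. For $s\in\mathfrak{S}_\Bbbk$ and $q(x)=\sum_i c_ix^i\in\Bbbk[x]$ put $\langle s,q\rangle=\sum_i c_i s_i$. The divided derivatives $\delta^m:\Bbbk[x]\to\Bbbk[x]$ are defined by $q(x+y)=\sum_{m\ge 0}(\delta^m q)(x)\,y^m$ in $\Bbbk[x,y]$. $D^m:\mathfrak{S}_\Bbbk\to\mathfrak{S}_\Bbbk$ is the unique map with $\langle D^m(s),q\rangle=\langle s,\delta^m(q)\rangle$ for all $s,q$. $L$ is the left shift $(Ls)_i=s_{i+1}$, and $p(L)=L^n+c_1L^{n-1}+\dots+c_n\,\mathrm{id}$. For $\alpha\in\Bbbk$,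 $s(\alpha)_i=\alpha^i$ (with $\alpha^0=1$) and $s(\alpha,m)=D^m(s(\alpha))$. *)

(* Defs.v *)
From HB Require Import structures.
From mathcomp Require Import all_boot all_algebra.
From mathcomp Require Import boolp classical_sets functions.
From mathcomp Require Import generic_quotient ring_quotient.
Set Implicit Arguments.
Unset Strict Implicit.
Unset Printing Implicit Defensive.
Import GRing.Theory.
Local Open Scope ring_scope.
Local Open Scope classical_set_scope.

Section Modules.
Variable R : nzRingType.

Definition torsion_module (M : lmodType R) : Prop :=
  forall m : M, exists c : R, c != 0 /\ c *: m = 0.

Section Span.
Variable V : lmodType R.

(* The intersection of all submodules containing A. *)
Definition span (A : set V) : {pred V} := fun v =>
  `[< forall N : {pred V}, submod_closed N ->
        (forall x, A x -> x \in N) -> v \in N >].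

Lemma span_gen (A : set V) x : A x -> x \in span A.
Proof. by move=> Ax; apply/asboolP => N _; apply. Qed.

Lemma span_min (A : set V) (N : {pred V}) :
  submod_closed N -> (forall x, A x -> x \in N) -> {subset span A <= N}.
Proof. by move=> sN AN x /asboolP; apply. Qed.

Lemma span_submod_closed (A : set V) : submod_closed (span A).
Proof.
split=> [|c u v /asboolP uA /asboolP vA].
  by apply/asboolP => N [].
apply/asboolP => N sN AN; case: (sN) => _; apply; [exact: uA|exact: vA].
Qed.

HB.instance Definition _ (A : set V) :=
  GRing.isSubmodClosed.Build R V (span A) (span_submod_closed A).

End Span.

Section QuotMod.
Variables (V : lmodType R) (N : submodClosed V).

(* Over a ring, submodules are closed under opposite, but submodClosed does not
   inherit from the zmodClosed structure required by Quotient.quot. *)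
Definition submod_zmod : {pred V} := N.

Lemma submod_zmod_closed : zmod_closed submod_zmod.
Proof.
split=> [|x y xN yN]; first exact: (@rpred0 _ N).
by rewrite -scaleN1r; apply: (@rpredD _ N) => //; exact: (@rpredZ _ _ N).
Qed.

HB.instance Definition _ :=
  GRing.isZmodClosed.Build V submod_zmod submod_zmod_closed.

(* The library provides the quotient abelian group, without scaling. *)
Definition quotmod : Type := Quotient.quot submod_zmod.

HB.instance Definition _ := GRing.Zmodule.on quotmod.

Definition quotmod_pi (v : V) : quotmod := \pi_(Quotient.quot submod_zmod)%qT v.

Definition quotmod_scale (c : R) (x : quotmod) : quotmod :=
  quotmod_pi (c *: repr (x : Quotient.quot submod_zmod)).

Lemma quotmod_piP (u v : V) : quotmod_pi u = quotmod_pi v <-> u - v \in N.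
Proof.
rewrite -[u - v \in N]/(u - v \in submod_zmod) Quotient.idealrBE; split=> [h|/eqP //].
by apply/eqP; exact: h.
Qed.

Lemma quotmod_piS (x : quotmod) : quotmod_pi (repr (x : Quotient.quot submod_zmod)) = x.
Proof. exact: reprK. Qed.

Lemma quotmod_piD (u v : V) :
  quotmod_pi (u + v) = quotmod_pi u + quotmod_pi v.
Proof. exact: (raddfD (\pi_(Quotient.quot submod_zmod)%qT)). Qed.

Lemma quotmod_scale_pi c v :
  quotmod_scale c (quotmod_pi v) = quotmod_pi (c *: v).
Proof.
apply/quotmod_piP; rewrite -scalerBr rpredZ //.
by apply/quotmod_piP; rewrite quotmod_piS.
Qed.

Lemma quotmod_scalerA a b x :
  quotmod_scale a (quotmod_scale b x) = quotmod_scale (a * b) x.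
Proof. by rewrite -[x]quotmod_piS !quotmod_scale_pi scalerA. Qed.

Lemma quotmod_scale1r : left_id 1 quotmod_scale.
Proof. by move=> x; rewrite -[x]quotmod_piS quotmod_scale_pi scale1r. Qed.

Lemma quotmod_scalerDr : right_distributive quotmod_scale +%R.
Proof.
move=> c x y; rewrite -[x]quotmod_piS -[y]quotmod_piS -quotmod_piD.
by rewrite !quotmod_scale_pi scalerDr quotmod_piD.
Qed.

Lemma quotmod_scalerDl x :
  {morph quotmod_scale^~ x : a b / a + b >-> a + b}.
Proof.
move=> a b; rewrite -[x]quotmod_piS !quotmod_scale_pi scalerDl.
by rewrite quotmod_piD.
Qed.

HB.instance Definition _ := GRing.Zmodule_isLmodule.Build R quotmod
  quotmod_scalerA quotmod_scale1r quotmod_scalerDr quotmod_scalerDl.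

Lemma quotmod_piZ c v : quotmod_pi (c *: v) = c *: quotmod_pi v.
Proof. by rewrite -quotmod_scale_pi. Qed.

End QuotMod.
End Modules.

Section Sequences.
Variable R : idomainType.

(* Functions nat -> R^o carry the termwise R-module structure. *)
Definition sequences : Type := nat -> R^o.

HB.instance Definition _ := GRing.Lmodule.on sequences.

Definition pairing (s : sequences) (q : {poly R}) : R :=
  \sum_(i < size q) q`_i * s i.

(* In {poly {poly R}} the outer variable 'X is y and 'X%:P is x, so
   q^:P \Po ('X%:P + 'X) is q(x + y). *)
Definition divided_derivative (m : nat) (q : {poly R}) : {poly R} :=
  (q^:P \Po ('X%:P + 'X))`_m.

Definition seqD (m : nat) (s : sequences) : sequences :=
  fun i => pairing s (divided_derivative m 'X^i).

Definition shiftL (s : sequences) : sequences := fun i => s i.+1.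

Definition polyL (p : {poly R}) (s : sequences) : sequences :=
  \sum_(i < size p) p`_i *: iter i shiftL s.

Definition geomseq (alpha : R) : sequences := fun i => alpha ^+ i.

Definition rootseq (alpha : R) (m : nat) : sequences := seqD m (geomseq alpha).

Lemma pairing_widen s (q : {poly R}) n : (size q <= n)%N ->
  pairing s q = \sum_(i < n) q`_i * s i.
Proof.
move=> qn; rewrite /pairing (big_ord_widen n (fun i => q`_i * s i) qn).
rewrite big_mkcond /=; apply: eq_bigr => i _.
by case: ltnP => // /(nth_default 0) ->; rewrite mul0r.
Qed.

Lemma pairingDZ s c (q r : {poly R}) : pairing s (c *: q + r) = c * pairing s q + pairing s r.
Proof.
pose n := maxn (size q) (size r).
have qn : (size q <= n)%N by exact: leq_maxl.
have rn : (size r <= n)%N by exact: leq_maxr.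
have cn : (size (c *: q + r)%R <= n)%N.
  apply: leq_trans (size_polyD _ _) _.
  by rewrite geq_max rn (leq_trans (size_scale_leq _ _)).
rewrite (pairing_widen s qn) (pairing_widen s rn) (pairing_widen s cn).
rewrite mulr_sumr -big_split /=; apply: eq_bigr => i _.
by rewrite coefD coefZ mulrDl mulrA.
Qed.

Lemma pairing0 s : pairing s 0 = 0.
Proof. by rewrite /pairing size_poly0 big_ord0. Qed.

Lemma pairing_sum s n (c : nat -> R) (q : nat -> {poly R}) :
  pairing s (\sum_(i < n) c i *: q i) = \sum_(i < n) c i * pairing s (q i).
Proof.
elim: n => [|n IHn]; first by rewrite !big_ord0 pairing0.
by rewrite !big_ord_recr /= addrC pairingDZ IHn addrC.
Qed.

Lemma pairingXn s i : pairing s 'X^i = s i.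
Proof.
rewrite /pairing size_polyXn big_ord_recr /= coefXn eqxx mul1r big1 ?add0r //.
by move=> j _; rewrite coefXn ltn_eqF ?mul0r.
Qed.

Lemma divided_derivativeDZ m c q r :
  divided_derivative m (c *: q + r) =
  c *: divided_derivative m q + divided_derivative m r.
Proof.
rewrite /divided_derivative rmorphD /= comp_polyD coefD; congr (_ + _).
by rewrite map_polyZ /= comp_polyZ coefZ mul_polyC.
Qed.

Lemma divided_derivative_sum m n (c : nat -> R) (q : nat -> {poly R}) :
  divided_derivative m (\sum_(i < n) c i *: q i) =
  \sum_(i < n) c i *: divided_derivative m (q i).
Proof.
elim: n => [|n IHn].
  by rewrite !big_ord0 /divided_derivative rmorph0 comp_poly0 coef0.
by rewrite !big_ord_recr /= addrC divided_derivativeDZ IHn addrC.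
Qed.

(* q(x + y) = \sum_m (divided_derivative m q)(x) y^m *)
Lemma divided_derivativeP (q : {poly R}) :
  q^:P \Po ('X%:P + 'X) = \poly_(m < size q) divided_derivative m q.
Proof.
apply/polyP => m; rewrite coef_poly; case: ltnP => // qm.
rewrite nth_default // size_comp_poly2 ?size_map_polyC //.
by rewrite addrC size_XaddC.
Qed.

Lemma pairing_seqD m s q :
  pairing (seqD m s) q = pairing s (divided_derivative m q).
Proof.
rewrite -{2}[q]coefK poly_def.
rewrite (divided_derivative_sum m _ (fun i => q`_i) (fun i => 'X^i)).
by rewrite (pairing_sum s _ (fun i => q`_i)
              (fun i => divided_derivative m 'X^i)).
Qed.

Lemma seqD_unique m (F : sequences -> sequences) :
  (forall s q, pairing (F s) q = pairing s (divided_derivative m q)) ->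
  F = seqD m.
Proof.
move=> FP; apply/funext => s; apply/funext => i.
by rewrite -[LHS]pairingXn FP.
Qed.

Lemma iter_shiftL i s j : iter i shiftL s j = s (i + j)%N.
Proof. by elim: i j => //= i IHi j; rewrite /shiftL IHi addnS. Qed.

Lemma polyLE p s j : polyL p s j = \sum_(i < size p) p`_i * s (i + j)%N.
Proof.
rewrite /polyL fct_sumE; apply: eq_bigr => i _.
by rewrite -(iter_shiftL i s j).
Qed.

Lemma polyL_linear p c s t : polyL p (c *: s + t) = c *: polyL p s + polyL p t.
Proof.
apply/funext => j.
transitivity (c * polyL p s j + polyL p t j) => //.
rewrite !polyLE mulr_sumr -big_split /=; apply: eq_bigr => i _.
transitivity (p`_i * (c * s (i + j)%N + t (i + j)%N)) => //.
by rewrite mulrDr mulrCA.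
Qed.

Lemma polyL_pairing p s j : polyL p s j = pairing s (p * 'X^j).
Proof.
rewrite polyLE -[in RHS](coefK p) poly_def mulr_suml.
under [in RHS]eq_bigr => i _ do rewrite -scalerAl -exprD.
rewrite (pairing_sum s _ (fun i => p`_i) (fun i => 'X^(i + j))).
by apply: eq_bigr => i _; rewrite pairingXn.
Qed.

Lemma pairing_rootseq alpha m q :
  pairing (rootseq alpha m) q = (q \Po ('X + alpha%:P))`_m.
Proof.
rewrite pairing_seqD; set d := divided_derivative m q.
have -> : pairing (geomseq alpha) d = d.[alpha] by rewrite horner_coef.
rewrite -[d.[alpha]]/(horner_eval alpha d) /d /divided_derivative.
rewrite -coef_map /=; congr (_`_m).
rewrite map_comp_poly rmorphD /= map_polyC map_polyX /= horner_evalE hornerX.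
rewrite addrC; congr (_ \Po _).
by apply/polyP => i; rewrite !coef_map /= horner_evalE hornerC.
Qed.

Definition in_kerL (p : {poly R}) : {pred sequences} := fun s => polyL p s == 0.

Lemma in_kerL_submod_closed p : submod_closed (in_kerL p).
Proof.
have polyL0 : polyL p 0 = 0.
  apply/funext => j; rewrite polyLE big1 // => i _.
  by rewrite [(0 : sequences) _](_ : _ = 0) ?mulr0.
split=> [|c s t /eqP hs /eqP ht]; apply/eqP; first exact: polyL0.
by rewrite polyL_linear hs ht scaler0 addr0.
Qed.

HB.instance Definition _ p := GRing.isSubmodClosed.Build R sequences (in_kerL p)
  (in_kerL_submod_closed p).

Record kerL (p : {poly R}) : Type :=
  KerL { kerL_val : sequences; kerL_valP : kerL_val \in in_kerL p }.

HB.instance Definition _ p := [isSub for @kerL_val p].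
HB.instance Definition _ p := [Choice of kerL p by <:].
HB.instance Definition _ p := [SubChoice_isSubLmodule of kerL p by <:].

Section Roots.
Variables (p : {poly R}) (k : nat) (alpha : 'I_k -> R) (mu : 'I_k -> nat).
Hypothesis p_split : p = \prod_(u < k) ('X - (alpha u)%:P) ^+ mu u.

Lemma rootseq_in_kerL u (a : 'I_(mu u)) : rootseq (alpha u) a \in in_kerL p.
Proof.
apply/eqP/funext => j; rewrite polyL_pairing pairing_rootseq.
rewrite p_split (bigD1 u) //= -mulrA comp_polyM.
rewrite rmorphXn /= comp_polyB comp_polyX comp_polyC addrK coefXnM.
by rewrite ltn_ord.
Qed.

Definition kerL_rootseq u (a : 'I_(mu u)) : kerL p := KerL (rootseq_in_kerL a).

Definition rootspan : {pred kerL p} :=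
  span [set s | exists u (a : 'I_(mu u)), s = kerL_rootseq a].

HB.instance Definition _ := GRing.SubmodClosed.on rootspan.

End Roots.
End Sequences.

(* Main.v *)
Require Import Defs.
From mathcomp Require Import all_boot all_algebra.
From mathcomp Require Import boolp classical_sets functions.
Set Implicit Arguments.
Unset Strict Implicit.
Unset Printing Implicit Defensive.
Import GRing.Theory.
Local Open Scope ring_scope.

(** Up to torsion, [Ker p(L)] splits along coprime factors of [p]: over a domain
    coprime polynomials [f], [g] satisfy a Bezout relation [A f + B g = c] with
    [c != 0] a constant, so if [f g] kills [s] then [c s] is the sum of
    [(A f)(L) s], killed by [g], and [(B g)(L) s], killed by [f]. For
    [f = (X - alpha)^mu] no denominator is needed: pairing [s] with the Taylor
    expansion at [alpha] of [X^i] shows that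
    [s = \sum_(a < mu) <s, (X - alpha)^a> s(alpha, a)]. *)

(** Under the pairing, [polyL f] is adjoint to multiplication by [f]. Identities between operators
    thus reduce to identities in the commutative ring [{poly R}]. *)
Lemma pairing_polyL (R : idomainType) (f q : {poly R}) (s : sequences R) :
  pairing (polyL f s) q = pairing s (f * q).
Proof.
rewrite -[in RHS](coefK q) poly_def mulr_sumr.
under [in RHS]eq_bigr => i _ do rewrite -scalerAr.
rewrite (pairing_sum s _ (fun i => q`_i) (fun i => f * 'X^i)).
by apply: eq_bigr => i _; rewrite polyL_pairing.
Qed.

Lemma polyLM (R : idomainType) (f g : {poly R}) (s : sequences R) :
  polyL (f * g) s = polyL f (polyL g s).
Proof.
apply/funext => j.
by rewrite !polyL_pairing pairing_polyL mulrA [g * f]mulrC.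
Qed.

Lemma polyLD (R : idomainType) (f g : {poly R}) (s : sequences R) :
  polyL (f + g) s = polyL f s + polyL g s.
Proof.
apply/funext => j; transitivity (polyL f s j + polyL g s j) => //.
by rewrite !polyL_pairing mulrDl -[f * _]scale1r pairingDZ mul1r scale1r.
Qed.

Lemma polyLC (R : idomainType) (c : R) (s : sequences R) :
  polyL c%:P s = c *: s.
Proof.
apply/funext => j; transitivity (c * s j) => //.
by rewrite polyL_pairing mul_polyC -[_ *: _]addr0 pairingDZ pairing0 addr0
           pairingXn.
Qed.

Lemma polyL0r (R : idomainType) (f : {poly R}) :
  polyL f (0 : sequences R) = 0.
Proof. by apply/eqP; case: (in_kerL_submod_closed f). Qed.

Lemma polyL_mul_eq0 (R : idomainType) (f g : {poly R}) (s : sequences R) :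
  polyL f s = 0 -> polyL (g * f) s = 0.
Proof. by move=> fs0; rewrite polyLM fs0 polyL0r. Qed.

Lemma taylor_kerL (R : idomainType) (alpha : R) (mu : nat) (s : sequences R) :
  polyL (('X - alpha%:P) ^+ mu) s = 0 ->
  s = \sum_(a < mu) pairing s (('X - alpha%:P) ^+ a) *: rootseq alpha a.
Proof.
move=> fs0; apply/funext => i; rewrite fct_sumE.
(* By adjointness [s] annihilates every multiple of [('X - alpha%:P) ^+ mu]. *)
have pairing_eq0 a : (mu <= a)%N -> pairing s (('X - alpha%:P) ^+ a) = 0.
  move=> mua; rewrite -(subnKC mua) exprD -pairing_polyL fs0 /pairing.
  by rewrite big1 // => j _; exact: mulr0.
(* By [pairing_rootseq], the coefficient of index [a] of [r] is [rootseq alpha a i]; substituting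
   ['X - alpha%:P] back into [r] gives the Taylor expansion of ['X^i] at [alpha]. *)
pose r := 'X^i \Po ('X + alpha%:P).
have rE : 'X^i = \sum_(a < size r) r`_a *: ('X - alpha%:P) ^+ a.
  rewrite -comp_polyE /r -comp_polyA comp_polyD comp_polyX comp_polyC.
  by rewrite subrK comp_polyXr.
rewrite -{1}(pairingXn s i) rE.
rewrite (pairing_sum s _ (fun a => r`_a) (fun a => ('X - alpha%:P) ^+ a)).
pose F a := r`_a * pairing s (('X - alpha%:P) ^+ a).
(* The lengths [size r] and [mu] are unrelated, so both sums are extended to their maximum: past
   [size r] the coefficient vanishes, past [mu] the pairing does. *)
transitivity (\sum_(a < maxn (size r) mu) F a).
  rewrite (big_ord_widen _ F (leq_maxl _ mu)) big_mkcond /=.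
  apply: eq_bigr => a _; case: ltnP => // ra.
  by rewrite /F nth_default ?mul0r.
transitivity (\sum_(a < mu) F a).
  rewrite (big_ord_widen _ F (leq_maxr (size r) mu)) [RHS]big_mkcond /=.
  by apply: eq_bigr => a _; case: ltnP => // /pairing_eq0; rewrite /F => ->;
     rewrite mulr0.
apply: eq_bigr => a _; rewrite /F mulrC.
transitivity (pairing s (('X - alpha%:P) ^+ a) * rootseq alpha a i) => //.
by rewrite -[rootseq alpha a i]pairingXn pairing_rootseq.
Qed.

(** The Bezout combination is only associate to 1 up to nonzero scalars, so it has size 1: a nonzero
    constant, not necessarily a unit. *)
Lemma coprimep_bezout_const (R : idomainType) (f g : {poly R}) :
  coprimep f g -> exists A B : {poly R}, exists2 c : R, c != 0 &
    A * f + B * g = c%:P.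
Proof.
case/Bezout_coprimepP => -[A B] /=; rewrite -size_poly_eq1 => /size_poly1P.
by case=> c c0 ABc; exists A, B, c.
Qed.

(** For a submodule [N], these are the vectors whose class modulo [N] is torsion. *)
Definition torsion_closure (R : idomainType) (V : lmodType R)
    (N : {pred V}) (v : V) : Prop :=
  exists2 c : R, c != 0 & c *: v \in N.

Lemma torsion_closureD (R : idomainType) (V : lmodType R)
    (N : submodClosed V) (u v : V) :
  torsion_closure N u -> torsion_closure N v -> torsion_closure N (u + v).
Proof.
move=> [c c0 cu] [d d0 dv]; exists (c * d); first by rewrite mulf_neq0.
by rewrite scalerDr {1}mulrC -!scalerA rpredD // rpredZ.
Qed.

Lemma torsion_closureZ (R : idomainType) (V : lmodType R)
    (N : {pred V}) (c : R) (v : V) :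
  c != 0 -> torsion_closure N (c *: v) -> torsion_closure N v.
Proof.
by move=> c0 [d d0]; rewrite scalerA => dcv; exists (d * c); rewrite ?mulf_neq0.
Qed.

(** The generators live in the space of all sequences, so that the target stays fixed while the
    induction on the factors replaces the polynomial by partial products. *)
Definition rootseqs (R : idomainType) (k : nat) (alpha : 'I_k -> R)
    (mu : 'I_k -> nat) : set (sequences R) :=
  [set s | exists u (a : 'I_(mu u)), s = rootseq (alpha u) a]%classic.

Lemma kerL_prod_torsion (R : idomainType) (k : nat) (alpha : 'I_k -> R)
    (mu : 'I_k -> nat) (r : seq 'I_k) (s : sequences R) :
  injective alpha -> uniq r ->
  polyL (\prod_(u <- r) ('X - (alpha u)%:P) ^+ mu u) s = 0 ->
  torsion_closure (Defs.span (rootseqs alpha mu)) s.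
Proof.
move=> alpha_inj; elim: r s => [|v r IHr] s.
  rewrite big_nil polyLC scale1r => _ ->.
  by exists 1; rewrite ?oner_neq0 // scaler0 rpred0.
rewrite cons_uniq big_cons => /andP[vr r_uniq].
set f := ('X - _) ^+ _; set g := \prod_(u <- r) _ => fgs0.
have /coprimep_bezout_const[A [B [c c0 ABc]]] : coprimep f g.
  (* Exponents do not affect this direction of coprimality, so it suffices that [alpha u] and
     [alpha v] differ for [u] in [r], which follows from [v \notin r]. *)
  rewrite /g big_seq; elim/big_rec: _ => [|u h ur fh]; first exact: coprimep1.
  rewrite coprimepMr fh andbT coprimep_expl // coprimep_expr //.
  rewrite coprimep_XsubC rootE hornerXsubC subr_eq0 inj_eq //.
  by apply: contraNneq vr => <-.
apply: (@torsion_closureZ _ _ _ c) => //.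
rewrite -polyLC -ABc polyLD; apply: torsion_closureD.
  (* The summand from [A * f] is killed by [g], to which the induction hypothesis applies. *)
  apply: IHr => //; rewrite -polyLM mulrC -mulrA.
  exact: polyL_mul_eq0.
(* The summand from [B * g] is killed by [f], so it lies in the span itself. *)
exists 1; rewrite ?oner_neq0 // scale1r.
rewrite (@taylor_kerL _ (alpha v) (mu v) (polyL _ s)).
  rewrite rpred_sum // => a _; rewrite rpredZ //.
  by apply: span_gen; exists v, a.
by rewrite -polyLM mulrC -mulrA [g * _]mulrC; exact: polyL_mul_eq0.
Qed.

(** The image of [rootspan p_split] under [val] is a submodule of the sequences containing all
    generators, hence contains their span. *)
Lemma rootseqs_span_val (R : idomainType) (p : {poly R}) (k : nat)
    (alpha : 'I_k -> R) (mu : 'I_k -> nat)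
    (p_split : p = \prod_(u < k) ('X - (alpha u)%:P) ^+ mu u)
    (s : sequences R) :
  s \in Defs.span (rootseqs alpha mu) ->
  exists2 w : kerL p, w \in rootspan p_split & val w = s.
Proof.
pose N : {pred sequences R} :=
  fun t => `[< exists2 w : kerL p, w \in rootspan p_split & val w = t >].
suff /span_min spanN : submod_closed N.
  move=> s_span; apply/asboolP; apply: spanN s_span => _ [u [a ->]].
  apply/asboolP; exists (kerL_rootseq p_split a) => //.
  by apply: span_gen; exists u, a.
split=> [|c t t' /asboolP[w wS <-] /asboolP[w' wS' <-]]; apply/asboolP.
  by exists 0; rewrite ?rpred0.
by exists (c *: w + w'); rewrite ?rpredD ?rpredZ.
Qed.

Theorem theorem7p5 (R : idomainType) (p : {poly R}) (k : nat)
    (alpha : 'I_k -> R) (mu : 'I_k -> nat)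
    (p_monic : p \is monic)
    (alpha_inj : injective alpha)
    (mu_gt0 : forall u, (0 < mu u)%N)
    (p_split : p = \prod_(u < k) ('X - (alpha u)%:P) ^+ mu u) :
  torsion_module (quotmod (rootspan p_split)).
Proof.
move=> x; rewrite -[x]quotmod_piS; set m := generic_quotient.repr _.
(* Listing all indices makes the product equal to [p], which kills the representative [m]. *)
have [|c c0 /(rootseqs_span_val p_split)[w wS wE]] :=
  @kerL_prod_torsion R k alpha mu (index_enum _) (val m) alpha_inj
    (index_enum_uniq _).
  by rewrite -p_split; apply/eqP; exact: valP m.
exists c; split=> //; rewrite -quotmod_piZ.
have -> : c *: m = w by apply: val_inj; rewrite wE.
transitivity (quotmod_pi (rootspan p_split) 0).
  by apply/quotmod_piP; rewrite subr0.
by rewrite -(scale0r w) quotmod_piZ scale0r.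
Qed.
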